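(* Every 2-local derivation $\Delta: W(2,2)\to W(2,2)$ on the W-algebra $W(2,2)$ is a derivation of $W(2,2)$.
   Context: All algebras are over $\mathbb{C}$. The W-algebra $W(2,2)$ is the infinite-dimensional complex Lie algebra with $\mathbb{C}$-basis $\{L_m, I_m \mid m\in\mathbb{Z}\}$ and Lie brackets $[L_m,L_n]=(m-n)L_{m+n}$, $[L_m,I_n]=(m-n)I_{m+n}$, $[I_m,I_n]=0$ for all $m,n\in\mathbb{Z}$. A derivation of a Lie algebra $\mathcal{L}$ is a linear map $\delta:\mathcal{L}\to\mathcal{L}$ with $\delta([x,y])=[\delta(x),y]+[x,\delta(y)]$ for all $x,y\in\mathcal{L}$. A map $\Delta:\mathcal{L}\to\mathcal{L}$ (not assumed linear) is called a 2-local derivation if for every $x,y\in\mathcal{L}$ there exists a derivation $\Delta_{x,y}:\mathcal{L}\to\mathcal{L}$ (depending on $x,y$) such that $\Delta(x)=\Delta_{x,y}(x)$ and $\Delta(y)=\Delta_{x,y}(y)$. *)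

(* Defs.v *)
From HB Require Import structures.
From mathcomp Require Import all_boot all_order all_algebra.
From mathcomp Require Import finmap monalg.
From mathcomp Require Import ring.

Set Implicit Arguments.
Unset Strict Implicit.
Unset Printing Implicit Defensive.

Import GRing.Theory Num.Theory.
Local Open Scope ring_scope.

Definition is_lie_bracket (K : fieldType) (V : lmodType K)
    (br : V -> V -> V) : Prop :=
  [/\ forall y, linear (br^~ y),
      forall x, linear (br x),
      forall x, br x x = 0
    & forall x y z, br x (br y z) + br y (br z x) + br z (br x y) = 0].

Definition is_derivation (K : fieldType) (V : lmodType K)
    (br : V -> V -> V) (d : V -> V) : Prop :=
  linear d /\ forall x y, d (br x y) = br (d x) y + br x (d y).

Definition is_2local_derivation (K : fieldType) (V : lmodType K)
    (br : V -> V -> V) (D : V -> V) : Prop :=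
  forall x y, exists d : V -> V,
    [/\ is_derivation br d, D x = d x & D y = d y].

(* inl m indexes L_m and inr m indexes I_m; {malg K[T]} is the free K-module
   on T, of which only the K-linear structure is used. *)
Definition W22 (K : fieldType) := {malg K[(int + int)%type]}.
HB.instance Definition _ (K : fieldType) := GRing.Lmodule.on (W22 K).

HB.lock Definition W22L (K : fieldType) (m : int) : W22 K := << inl m >>.
HB.lock Definition W22I (K : fieldType) (m : int) : W22 K := << inr m >>.

Definition W22_bracket_basis (K : fieldType) (a b : int + int) : W22 K :=
  match a, b with
  | inl m, inl n => (m - n)%:~R *: W22L K (m + n)
  | inl m, inr n => (m - n)%:~R *: W22I K (m + n)
  | inr m, inl n => - ((n - m)%:~R *: W22I K (n + m))
  | inr _, inr _ => 0
  end.

(* Bilinear extension of the bracket on basis elements.  It is locked, like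
   the basis vectors, since unification otherwise unfolds malg. *)
HB.lock Definition W22_bracket (K : fieldType) (x y : W22 K) : W22 K :=
  \sum_(a <- msupp x) \sum_(b <- msupp y)
    (x@_a * y@_b) *: W22_bracket_basis K a b.

Section Facts.
Variable K : fieldType.
Implicit Types (x y z : W22 K) (m n : int) (a b c : (int + int)%type).

Local Notation br := (@W22_bracket K).
Local Notation e a := (<< a >> : W22 K).

Lemma W22_bracketEw (d1 d2 : {fset (int + int)%type}) x y :
  (msupp x `<=` d1)%fset -> (msupp y `<=` d2)%fset ->
  br x y = \sum_(a <- d1) \sum_(b <- d2)
             (x@_a * y@_b) *: W22_bracket_basis K a b.
Proof.
move=> s1 s2; rewrite unlock (big_fset_incl _ s1) /=; last first.
  move=> a _ /mcoeff_outdom ->; apply: big1 => b _.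
  by rewrite mul0r scale0r.
apply: eq_bigr => a _; rewrite (big_fset_incl _ s2) //= => b _.
by move=> /mcoeff_outdom ->; rewrite mulr0 scale0r.
Qed.

Lemma W22_bracket_linearl y : linear (br^~ y).
Proof.
move=> k x x'.
set d1 := (msupp x `|` msupp x' `|` msupp (k *: x + x'))%fset.
have s0 : (msupp (k *: x + x') `<=` d1)%fset by apply: fsubsetUr.
have s1 : (msupp x `<=` d1)%fset.
  by rewrite /d1 -fsetUA; apply: fsubsetUl.
have s2 : (msupp x' `<=` d1)%fset.
  by rewrite /d1 -fsetUA fsetUCA; apply: fsubsetUl.
rewrite (W22_bracketEw s0 (fsubset_refl _)) (W22_bracketEw s1 (fsubset_refl _)).
rewrite (W22_bracketEw s2 (fsubset_refl _)) scaler_sumr -big_split /=.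
apply: eq_bigr => a _; rewrite scaler_sumr -big_split /=.
apply: eq_bigr => b _.
by rewrite mcoeffD mcoeffZ mulrDl scalerDl scalerA mulrA.
Qed.

Lemma W22_bracket_linearr x : linear (br x).
Proof.
move=> k y y'.
set d1 := (msupp y `|` msupp y' `|` msupp (k *: y + y'))%fset.
have s0 : (msupp (k *: y + y') `<=` d1)%fset by apply: fsubsetUr.
have s1 : (msupp y `<=` d1)%fset.
  by rewrite /d1 -fsetUA; apply: fsubsetUl.
have s2 : (msupp y' `<=` d1)%fset.
  by rewrite /d1 -fsetUA fsetUCA; apply: fsubsetUl.
rewrite (W22_bracketEw (fsubset_refl _) s0) (W22_bracketEw (fsubset_refl _) s1).
rewrite (W22_bracketEw (fsubset_refl _) s2) scaler_sumr -big_split /=.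
apply: eq_bigr => a _; rewrite scaler_sumr -big_split /=.
apply: eq_bigr => b _.
by rewrite mcoeffD mcoeffZ mulrDr scalerDl scalerA mulrCA.
Qed.

Lemma W22_bracketU a b : br (e a) (e b) = W22_bracket_basis K a b.
Proof.
rewrite (@W22_bracketEw [fset a]%fset [fset b]%fset) ?msuppU_le //.
by rewrite !big_seq_fset1 !mcoeffUU mulr1 scale1r.
Qed.

Lemma W22LE m : W22L K m = e (inl m).
Proof. by rewrite W22L.unlock. Qed.

Lemma W22IE m : W22I K m = e (inr m).
Proof. by rewrite W22I.unlock. Qed.

Lemma W22_bracketLL m n :
  br (W22L K m) (W22L K n) = (m - n)%:~R *: W22L K (m + n).
Proof. by rewrite (W22LE m) (W22LE n) W22_bracketU. Qed.

Lemma W22_bracketLI m n :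
  br (W22L K m) (W22I K n) = (m - n)%:~R *: W22I K (m + n).
Proof. by rewrite (W22LE m) (W22IE n) W22_bracketU. Qed.

Lemma W22_bracketIL m n :
  br (W22I K m) (W22L K n) = (m - n)%:~R *: W22I K (m + n).
Proof.
rewrite (W22IE m) (W22LE n) W22_bracketU /=.
by rewrite -scaleNr -rmorphN opprB [n + m]addrC.
Qed.

Lemma W22_bracketII m n : br (W22I K m) (W22I K n) = 0.
Proof. by rewrite (W22IE m) (W22IE n) W22_bracketU. Qed.

Lemma W22_linear_eq0 (f : W22 K -> W22 K) : linear f ->
  (forall m, f (W22L K m) = 0) -> (forall m, f (W22I K m) = 0) ->
  forall x, f x = 0.
Proof.
move=> lf fL fI x.
pose g : {linear W22 K -> W22 K} :=
  HB.pack f (GRing.isLinear.Build K (W22 K) (W22 K) *:%R f lf).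
rewrite -[f x]/(g x) (monalgE x) raddf_sum big1 //= => a _.
have -> : << x@_a *g a >> = x@_a *: e a.
  by apply/malgP => b; rewrite mcoeffZ !mcoeffU mulrnAr mulr1.
rewrite -[f _]/(g _) linearZ /=.
by case: a => m; rewrite -?W22LE -?W22IE ?fL ?fI scaler0.
Qed.

Lemma W22_bracketDl x y z : br (x + y) z = br x z + br y z.
Proof. by have := W22_bracket_linearl z 1 x y; rewrite /= !scale1r. Qed.

Lemma W22_bracketDr x y z : br x (y + z) = br x y + br x z.
Proof. by have := W22_bracket_linearr x 1 y z; rewrite /= !scale1r. Qed.

Lemma W22_bracket0l y : br 0 y = 0.
Proof. by apply: (addrI (br 0 y)); rewrite -W22_bracketDl !addr0. Qed.

Lemma W22_bracket0r x : br x 0 = 0.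
Proof. by apply: (addrI (br x 0)); rewrite -W22_bracketDr !addr0. Qed.

Lemma W22_bracketZl k x y : br (k *: x) y = k *: br x y.
Proof.
have := W22_bracket_linearl y k x 0.
by rewrite /= !addr0 W22_bracket0l addr0.
Qed.

Lemma W22_bracketZr k x y : br x (k *: y) = k *: br x y.
Proof.
have := W22_bracket_linearr x k y 0.
by rewrite /= !addr0 W22_bracket0r addr0.
Qed.

Lemma W22_bracketC x y : br x y = - br y x.
Proof.
apply/eqP; rewrite -addr_eq0; apply/eqP.
have lin (f g : W22 K -> W22 K) : linear f -> linear g ->
    linear (fun u => f u + g u).
  by move=> lf lg k u v; rewrite lf lg scalerDr addrACA.
have L u := @W22_bracket_linearl u; have Rr u := @W22_bracket_linearr u.
have anti k m n (v : W22 K) : k = m - n -> 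
    k%:~R *: v + (n - m)%:~R *: v = 0.
  by move=> ->; rewrite -scalerDl -rmorphD /= -[n - m]opprB subrr scale0r.
move: x; apply: W22_linear_eq0 => [|m|m]; first exact: lin (L _) (Rr _).
- move: y; apply: W22_linear_eq0 => [|n|n]; first exact: lin (Rr _) (L _).
  + by rewrite !W22_bracketLL [n + m]addrC anti.
  + by rewrite W22_bracketLI W22_bracketIL [n + m]addrC anti.
- move: y; apply: W22_linear_eq0 => [|n|n]; first exact: lin (Rr _) (L _).
  + by rewrite W22_bracketLI W22_bracketIL [n + m]addrC anti.
  + by rewrite !W22_bracketII addr0.
Qed.

Lemma W22_jacobi x y z : br x (br y z) + br y (br z x) + br z (br x y) = 0.
Proof.
have lin (f g h : W22 K -> W22 K) : linear f -> linear g -> linear h ->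
    linear (fun u => f u + g u + h u).
  move=> lf lg lh k u v; rewrite /= lf lg lh !scalerDr.
  by rewrite [X in X + _ = _]addrACA [LHS]addrACA.
have lin2 (f g : W22 K -> W22 K) : linear f -> linear g -> linear (f \o g).
  by move=> lf lg k u v; rewrite /= lg lf.
have L u := @W22_bracket_linearl u; have Rr u := @W22_bracket_linearr u.
have key m n p (X : int -> W22 K) :
    (n - p)%:~R *: ((m - (n + p))%:~R *: X (m + (n + p)))
    + (p - m)%:~R *: ((n - (p + m))%:~R *: X (n + (p + m)))
    + (m - n)%:~R *: ((p - (m + n))%:~R *: X (p + (m + n))) = 0.
  have -> : n + (p + m) = m + (n + p) by ring.
  have -> : p + (m + n) = m + (n + p) by ring.
  rewrite !scalerA -!scalerDl -!rmorphM -!rmorphD /=.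
  set k := (X in X%:~R); suff -> : k = 0 by rewrite scale0r.
  rewrite /k; ring.
have linx u v : linear (fun x => br x (br u v) + br u (br v x) + br v (br x u)).
  apply: (lin _ _ _ (L _)); first exact: lin2 (Rr _) (Rr _).
  exact: lin2 (Rr _) (L _).
have liny u v : linear (fun y => br u (br y v) + br y (br v u) + br v (br u y)).
  apply: lin; [exact: lin2 (Rr _) (L _) | exact: L | exact: lin2 (Rr _) (Rr _)].
have linz u v : linear (fun z => br u (br v z) + br v (br z u) + br z (br u v)).
  apply: lin; [exact: lin2 (Rr _) (Rr _) | exact: lin2 (Rr _) (L _) | exact: L].
have E := (W22_bracketLL, W22_bracketLI, W22_bracketIL, W22_bracketII,
           W22_bracketZr, W22_bracket0r).
move: x; apply: W22_linear_eq0 (linx _ _) _ _ => m;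
move: y; apply: W22_linear_eq0 (liny _ _) _ _ => n;
move: z; apply: W22_linear_eq0 (linz _ _) _ _ => p;
by rewrite !E ?scaler0 ?addr0 ?key.
Qed.

End Facts.

Lemma W22_is_lie_bracket (K : numFieldType) : is_lie_bracket (@W22_bracket K).
Proof.
split; [exact: W22_bracket_linearl | exact: W22_bracket_linearr
       | | exact: W22_jacobi].
move=> x; have /eqP := W22_bracketC x x.
rewrite -addr_eq0 -mulr2n -scaler_nat scaler_eq0 pnatr_eq0 /=.
by move/eqP.
Qed.

(* Main.v *)
Require Import Defs.
From mathcomp Require Import all_boot all_order all_algebra.
From mathcomp Require Import finmap monalg ring zify.
From mathcomp Require Import reals complex.

Set Implicit Arguments.
Unset Strict Implicit.
Unset Printing Implicit Defensive.

Import GRing.Theory Num.Theory.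
Local Open Scope ring_scope.

(** Every derivation of W(2,2) is ad v + k * outer, where outer kills all L_m
    and fixes all I_m ([derivation_inner_outer]).  Let D be a 2-local
    derivation.  Subtracting a derivation that agrees with D at L_0 and L_1, we
    may suppose D L_0 = D L_1 = 0; the claim is then that D = k * outer.

    The centralizer of L_p is spanned by L_p and I_p, up to a multiple of outer.
    So D L_m lies both in the span of the degree m vectors (compare with L_0)
    and in the span of the degree m + 1 vectors (compare with L_1), hence
    D L_m = 0 for every m ([local_vanishes_at_L]).

    The second tool is a separation of supports.  If D x = [v, x] + k outer x
    with v in degrees p and 2p, and p is large compared with the supports of x
    and of D x, then [v, x] lives where both D x and outer x vanish, so
    D x = k outer x ([shift_out_of_support]).  Comparing x with L_p for large p
    gives such a v, with a scalar k that may depend on x.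

    To make the scalar uniform, x is compared instead with the probe
    L_p + I_{2p}.  A derivation whose value at the probe is a multiple of
    I_{2p} has that multiple as its outer coefficient, because
    an inner derivation that sends the probe to a multiple of I_{2p} sends it to
    zero ([stabilizer_probe]).  Hence D x = l_p outer x with l_p determined by
    D (L_p + I_{2p}) alone, for all large p.  Taking p large for both x and
    I_0, the scalar l_p is the one that D has at I_0, so it is the same for
    all x. *)

(** * Lie algebras with a basis satisfying the relations of W(2,2) *)

(** The argument uses only a Lie bracket, a basis L_m, I_m with the relations
    of W(2,2), and coordinates.  [coord_inj] and [scalar_eq0] express that the
    coordinates separate points and that the basis spans.  The operators [diag]
    are those that are diagonal in the basis: they provide both the outer
    derivation and the division by the degree in [inner_L0_correction]. *)
Record W22_basis (K : numFieldType) (V : lmodType K) (br : V -> V -> V) := {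
  bL : int -> V;
  bI : int -> V;
  cL : int -> V -> K;
  cI : int -> V -> K;
  diag : (int -> K) -> (int -> K) -> V -> V;
  br_lie : is_lie_bracket br;
  br_LL : forall m n, br (bL m) (bL n) = (m - n)%:~R *: bL (m + n);
  br_LI : forall m n, br (bL m) (bI n) = (m - n)%:~R *: bI (m + n);
  br_II : forall m n, br (bI m) (bI n) = 0;
  cL_scalar : forall n, scalar (cL n);
  cI_scalar : forall n, scalar (cI n);
  cL_L : forall m n, cL n (bL m) = (m == n)%:R;
  cI_L : forall m n, cI n (bL m) = 0;
  cL_I : forall m n, cL n (bI m) = 0;
  cI_I : forall m n, cI n (bI m) = (m == n)%:R;
  coord_inj : forall x y,
    cL^~ x =1 cL^~ y -> cI^~ x =1 cI^~ y -> x = y;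
  scalar_eq0 : forall f : V -> K, scalar f ->
    (forall m, f (bL m) = 0) -> (forall m, f (bI m) = 0) -> forall x, f x = 0;
  coord_finite : forall x, exists N : nat,
    forall n : int, (N < `|n|)%N -> cL n x = 0 /\ cI n x = 0;
  cL_diag : forall s t n x, cL n (diag s t x) = s n * cL n x;
  cI_diag : forall s t n x, cI n (diag s t x) = t n * cI n x
}.

(** * Linear maps and derivations of a Lie algebra *)

Lemma lin_D (K : nzRingType) (V W : lmodType K) (f : V -> W) x y :
  linear f -> f (x + y) = f x + f y.
Proof. by move=> lf; have := lf 1 x y; rewrite !scale1r. Qed.

Lemma lin_0 (K : nzRingType) (V W : lmodType K) (f : V -> W) :
  linear f -> f 0 = 0.
Proof. by move=> lf; apply: (addrI (f 0)); rewrite -lin_D // !addr0. Qed.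

Lemma lin_Z (K : nzRingType) (V W : lmodType K) (f : V -> W) k x :
  linear f -> f (k *: x) = k *: f x.
Proof. by move=> lf; have := lf k x 0; rewrite (lin_0 lf) !addr0. Qed.

Lemma lin_N (K : nzRingType) (V W : lmodType K) (f : V -> W) x :
  linear f -> f (- x) = - f x.
Proof. by move=> lf; rewrite -scaleN1r lin_Z // scaleN1r. Qed.

Section Derivations.
Variables (K : fieldType) (V : lmodType K) (br : V -> V -> V).
Hypothesis brP : is_lie_bracket br.
Implicit Types (x y z u v w : V) (k : K) (d : V -> V).

Lemma br_linearl y : linear (br^~ y). Proof. by case: brP. Qed.
Lemma br_linearr x : linear (br x). Proof. by case: brP. Qed.

Lemma brDl x y z : br (x + y) z = br x z + br y z.
Proof. exact: (lin_D _ _ (br_linearl z)). Qed.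
Lemma brDr x y z : br x (y + z) = br x y + br x z.
Proof. exact: (lin_D _ _ (br_linearr x)). Qed.
Lemma br0l y : br 0 y = 0.
Proof. exact: (lin_0 (br_linearl y)). Qed.
Lemma br0r x : br x 0 = 0.
Proof. exact: (lin_0 (br_linearr x)). Qed.
Lemma brZl k x y : br (k *: x) y = k *: br x y.
Proof. exact: (lin_Z _ _ (br_linearl y)). Qed.
Lemma brZr k x y : br x (k *: y) = k *: br x y.
Proof. exact: (lin_Z _ _ (br_linearr x)). Qed.
Lemma brNr x y : br x (- y) = - br x y.
Proof. exact: (lin_N _ (br_linearr x)). Qed.

Lemma brC x y : br x y = - br y x.
Proof.
have brxx z : br z z = 0 by case: brP.
apply/eqP; rewrite -addr_eq0; have := brxx (x + y).
by rewrite brDl !brDr !brxx add0r addr0 => ->.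
Qed.

Lemma inner_derivation u : is_derivation br (br u).
Proof.
split=> [|x y]; first exact: br_linearr.
have jac : br u (br x y) + br x (br y u) + br y (br u x) = 0 by case: brP.
apply/eqP; rewrite -subr_eq0 -jac (brC (br u x)) (brC y u) brNr.
by rewrite opprD opprK addrA addrAC.
Qed.

Lemma derivation_ext d d' : is_derivation br d -> d =1 d' ->
  is_derivation br d'.
Proof. by move=> [ld dd] eqd; split=> [k x y|x y]; rewrite -!eqd ?ld ?dd. Qed.

Lemma derivation_comb k d d' : is_derivation br d -> is_derivation br d' ->
  is_derivation br (fun x => k *: d x + d' x).
Proof.
move=> [ld dd] [ld' dd']; split=> [c x y|x y].
  by rewrite ld ld' !scalerDr !scalerA (mulrC k) addrACA.
by rewrite dd dd' brDl brDr brZl brZr scalerDr addrACA.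
Qed.

Lemma derivation_sub d d' : is_derivation br d -> is_derivation br d' ->
  is_derivation br (fun x => d x - d' x).
Proof.
move=> der der'; apply: derivation_ext (derivation_comb (-1) der' der) _.
by move=> x; rewrite scaleN1r addrC.
Qed.

Lemma is_2local_derivation_sub D d : is_2local_derivation br D ->
  is_derivation br d -> is_2local_derivation br (fun x => D x - d x).
Proof.
move=> locD der x y; have [d' [der' -> ->]] := locD x y.
by exists (fun x => d' x - d x); split=> //; apply: derivation_sub.
Qed.

End Derivations.

(** * Derivations of W(2,2) *)

(** The derivation identity on [L_m, L_n] = (m - n) L_{m+n} gives no information
    for m = n, so additivity is known only off the diagonal.  The missing value
    f 2 = 2 f 1 comes from writing 5 both as 4 + 1 and as 3 + 2. *)
Lemma additive_off_diagonal (K : comNzRingType) (f : int -> K) :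
  (forall m n, m != n -> f (m + n) = f m + f n) ->
  forall m, f m = m%:~R * f 1.
Proof.
move=> addf.
have f0 : f 0 = 0 by apply: (addrI (f 1)); rewrite -addf // !addr0.
have f2 : f 2 = 2 * f 1.
  have e3 : f 3 = f 2 + f 1 := addf 2 1 isT.
  have e4 : f 4 = f 3 + f 1 := addf 3 1 isT.
  have e5 : f 5 = f 4 + f 1 := addf 4 1 isT.
  have : f 5 = f 3 + f 2 := addf 3 2 isT.
  by rewrite e5 e4 e3 -[LHS]addrA => /addrI <-; ring.
have fN (n : nat) : f n%:Z = n%:~R * f 1.
  elim: n => [|[|[|n]] IHn]; rewrite ?f0 ?mul0r ?mul1r ?f2 //.
  have -> : n.+3%:Z = n.+2%:Z + 1 by lia.
  by rewrite addf; [rewrite IHn intrD [RHS]mulrDl mul1r | lia].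
case=> [|n]; first exact: fN.
have := addf n.+1%:Z (Negz n) isT; rewrite NegzE subrr f0 fN => /eqP.
by rewrite eq_sym addrC addr_eq0 rmorphN mulNr => /eqP.
Qed.

Section W22.
Variables (K : numFieldType) (V : lmodType K) (br : V -> V -> V).
Variable B : W22_basis br.
Implicit Types (x y z u v w : V) (m n p : int) (a b c k : K) (d : V -> V).

Local Notation L := (bL B).
Local Notation I := (bI B).
Local Notation cL := (cL B).
Local Notation cI := (cI B).
Local Notation brP := (br_lie B).

Lemma br_IL m n : br (I m) (L n) = (m - n)%:~R *: I (m + n).
Proof. by rewrite (brC brP) br_LI -scaleNr -rmorphN opprB [n + m]addrC. Qed.

Definition brE := (brDl brP, brDr brP, brZl brP, brZr brP,
  br_LL B, br_LI B, br_IL, br_II B).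

Lemma coordD n x y : (cL n (x + y) = cL n x + cL n y)
                   * (cI n (x + y) = cI n x + cI n y).
Proof.
split; apply: (@lin_D K V K^o).
- exact: cL_scalar.
- exact: cI_scalar.
Qed.

Lemma coordZ n k x : (cL n (k *: x) = k * cL n x)
                   * (cI n (k *: x) = k * cI n x).
Proof.
split; apply: (@lin_Z K V K^o).
- exact: cL_scalar.
- exact: cI_scalar.
Qed.

Lemma coordN n x : (cL n (- x) = - cL n x) * (cI n (- x) = - cI n x).
Proof.
split; apply: (@lin_N K V K^o).
- exact: cL_scalar.
- exact: cI_scalar.
Qed.

Lemma coord0 n : (cL n 0 = 0) * (cI n 0 = 0).
Proof.
split; apply: (@lin_0 K V K^o).
- exact: cL_scalar.
- exact: cI_scalar.
Qed.

Definition coordE :=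
  (coordD, coordZ, coordN, coord0, cL_L B, cI_L B, cL_I B, cI_I B).

Lemma scalar_ext (f g : V -> K) : scalar f -> scalar g ->
  (forall m, f (L m) = g (L m)) -> (forall m, f (I m) = g (I m)) -> f =1 g.
Proof.
move=> lf lg fgL fgI x; apply/eqP; rewrite -subr_eq0; apply/eqP.
apply: (@scalar_eq0 _ _ _ B (fun x => f x - g x)) x => [k x y|m|m].
- by rewrite lf lg /=; ring.
- by rewrite fgL subrr.
- by rewrite fgI subrr.
Qed.

Lemma linear_ext (f g : V -> V) : linear f -> linear g ->
  (forall m, f (L m) = g (L m)) -> (forall m, f (I m) = g (I m)) -> f =1 g.
Proof.
move=> lf lg fgL fgI x; apply: (coord_inj (w := B)) => n.
- apply: (@scalar_ext (cL n \o f) (cL n \o g)) x => [k x y|k x y|m|m] /=.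
  + by rewrite lf !coordE.
  + by rewrite lg !coordE.
  + by rewrite fgL.
  + by rewrite fgI.
- apply: (@scalar_ext (cI n \o f) (cI n \o g)) x => [k x y|k x y|m|m] /=.
  + by rewrite lf !coordE.
  + by rewrite lg !coordE.
  + by rewrite fgL.
  + by rewrite fgI.
Qed.

(** The structure constant m - p of the degree m + p component, rewritten in
    terms of the target degree n = m + p. *)
Lemma delta_shift m p n :
  (m - p)%:~R * (m + p == n)%:R = (2 * m - n)%:~R * (p == n - m)%:R :> K.
Proof.
rewrite eq_sym -[n == _](inj_eq (addIr (- m))) [m + p]addrC addrK eq_sym.
by case: eqP => [->|_]; rewrite ?mulr0 // !mulr1; congr _%:~R; ring.
Qed.

Lemma coord_brL m n x :
  (cL n (br (L m) x) = (2 * m - n)%:~R * cL (n - m) x)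
* (cI n (br (L m) x) = (2 * m - n)%:~R * cI (n - m) x).
Proof.
split.
- apply: (@scalar_ext (fun x => cL n (br (L m) x))
    (fun x => (2 * m - n)%:~R * cL (n - m) x)) x => [k x y|k x y|p|p] /=;
  by rewrite ?(brE, coordE) ?delta_shift ?mulr0 //=; ring.
- apply: (@scalar_ext (fun x => cI n (br (L m) x))
    (fun x => (2 * m - n)%:~R * cI (n - m) x)) x => [k x y|k x y|p|p] /=;
  by rewrite ?(brE, coordE) ?delta_shift ?mulr0 //=; ring.
Qed.

Lemma coord_brI m n x :
  (cL n (br (I m) x) = 0)
* (cI n (br (I m) x) = (2 * m - n)%:~R * cL (n - m) x).
Proof.
split.
- apply: (@scalar_ext (fun x => cL n (br (I m) x))
    (fun x => 0)) x => [k x y|k x y|p|p] /=;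
  by rewrite ?(brE, coordE) ?delta_shift ?mulr0 //=; ring.
- apply: (@scalar_ext (fun x => cI n (br (I m) x))
    (fun x => (2 * m - n)%:~R * cL (n - m) x)) x => [k x y|k x y|p|p] /=;
  by rewrite ?(brE, coordE) ?delta_shift ?mulr0 //=; ring.
Qed.

Definition coord_brE := (coord_brL, coord_brI).

(** The derivation attached to the grading in which every L_m has weight 0 and
    every I_m weight 1; it is not inner. *)
Definition outer : V -> V := diag B (fun=> 0) (fun=> 1).

Lemma coord_outer n x : (cL n (outer x) = 0) * (cI n (outer x) = cI n x).
Proof. by rewrite /outer cL_diag cI_diag mul0r mul1r. Qed.

Lemma outer_linear : linear outer.
Proof.
move=> k x y; apply: (coord_inj (w := B)) => n;
  by rewrite !(coord_outer, coordE) ?mulr0 ?addr0.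
Qed.

Lemma outer_L m : outer (L m) = 0.
Proof. by apply: (coord_inj (w := B)) => n; rewrite coord_outer !coordE. Qed.

Lemma outer_I m : outer (I m) = I m.
Proof. by apply: (coord_inj (w := B)) => n; rewrite coord_outer !coordE. Qed.

(** Both sides of the derivation identity are bilinear; the case of I_m and L_n
    follows from that of L_n and I_m by antisymmetry. *)
Lemma derivation_basisP d : linear d ->
  (forall m n, d (br (L m) (L n)) = br (d (L m)) (L n) + br (L m) (d (L n))) ->
  (forall m n, d (br (L m) (I n)) = br (d (L m)) (I n) + br (L m) (d (I n))) ->
  (forall m n, d (br (I m) (I n)) = br (d (I m)) (I n) + br (I m) (d (I n))) ->
  is_derivation br d.
Proof.
move=> ld dLL dLI dII; split=> // x y.
have lcomp (f g : V -> V) : linear f -> linear g -> linear (f \o g).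
  by move=> lf lg k u v; rewrite /= lg lf.
have ladd (f g : V -> V) : linear f -> linear g -> linear (fun u => f u + g u).
  by move=> lf lg k u v; rewrite lf lg scalerDr addrACA.
have lbr u := br_linearr brP u; have brl u := br_linearl brP u.
have dIL m n : d (br (I m) (L n)) = br (d (I m)) (L n) + br (I m) (d (L n)).
  rewrite (brC brP) (lin_N _ ld) dLI (brC brP (d (I m))) (brC brP (I m)).
  by rewrite opprD addrC.
have half u : (forall n, d (br u (L n)) = br (d u) (L n) + br u (d (L n))) ->
    (forall n, d (br u (I n)) = br (d u) (I n) + br u (d (I n))) ->
    forall y, d (br u y) = br (d u) y + br u (d y).
  apply: linear_ext; first exact: lcomp (lbr _).
  exact: ladd (lbr _) (lcomp _ _ (lbr _) ld).
apply: (@linear_ext (fun u => d (br u y)) (fun u => br (d u) y + br u (d y))) x.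
- exact: lcomp (brl _).
- exact: ladd (lcomp _ _ (brl _) ld) (brl _).
- by move=> m; apply: half.
- by move=> m; apply: half.
Qed.

Lemma outer_derivation : is_derivation br outer.
Proof.
apply: (derivation_basisP outer_linear) => m n.
- by rewrite br_LL (lin_Z _ _ outer_linear) !outer_L (br0l brP) (br0r brP)
     scaler0 addr0.
- by rewrite br_LI (lin_Z _ _ outer_linear) !outer_I outer_L (br0l brP) add0r
     br_LI.
- by rewrite !outer_I !br_II (lin_0 outer_linear) addr0.
Qed.

Lemma inner_outer_derivation v k :
  is_derivation br (fun x => br v x + k *: outer x).
Proof.
apply: derivation_ext (derivation_comb brP k outer_derivation
  (inner_derivation brP v)) _ => x.
by rewrite addrC.
Qed.

(** Since [L_n, L_0] = n L_n and [I_n, L_0] = n I_n, every component of nonzero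
    degree of v is divided by its degree. *)
Lemma inner_L0_correction v : exists u, forall n, n != 0 ->
  cL n (br u (L 0)) = cL n v /\ cI n (br u (L 0)) = cI n v.
Proof.
exists (diag B (fun n => n%:~R^-1) (fun n => n%:~R^-1) v) => n n0.
have n0K : n%:~R != 0 :> K by rewrite intr_eq0.
rewrite (brC brP) !(coordE, coord_brE) cL_diag cI_diag mulr0 subr0 sub0r.
by rewrite rmorphN mulNr opprK mulrA mulNr opprK mulrA mulfV // !mul1r.
Qed.

(** Apply d to [L_0, L_1] = - L_1: in degree 1 the terms with d L_1 cancel and
    those that remain are the degree 0 components of d L_0. *)
Lemma derivation_L0_eq0 d : is_derivation br d ->
  (forall n, n != 0 -> cL n (d (L 0)) = 0 /\ cI n (d (L 0)) = 0) ->
  d (L 0) = 0.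
Proof.
move=> [ld dd] dL0; have := dd (L 0) (L 1).
rewrite br_LL (lin_Z _ _ ld) (brC brP (d (L 0))) !add0r => eq1.
have key (a b : K) : (-1)%:~R * a = - ((2 * 1 - 1)%:~R * b) + (-1)%:~R * a ->
    b = 0.
  have -> : 2 * 1 - 1 = 1 :> int by [].
  by move=> /eqP; rewrite -subr_eq subrr eq_sym oppr_eq0 mul1r => /eqP.
apply: (coord_inj (w := B)) => n; rewrite coord0;
  have [->|/dL0[]//] := eqVneq n 0.
- have := congr1 (cL 1) eq1.
  by rewrite !(coordE, coord_brE) subrr mulr0 subr0 sub0r; exact: key.
- have := congr1 (cI 1) eq1.
  by rewrite !(coordE, coord_brE) subrr mulr0 subr0 sub0r; exact: key.
Qed.

(** A derivation that kills L_0 commutes with ad L_0, so it preserves its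
    eigenspaces, each of which is spanned by one L_m and one I_m. *)
Lemma derivation_homogeneous d m x : is_derivation br d -> d (L 0) = 0 ->
  br (L 0) x = (- m)%:~R *: x ->
  d x = cL m (d x) *: L m + cI m (d x) *: I m.
Proof.
move=> [ld dd] dL0 eigx; have := dd (L 0) x.
rewrite eigx (lin_Z _ _ ld) dL0 (br0l brP) add0r => eqd.
have key (a : K) n : n != m -> (- m)%:~R * a = (2 * 0 - n)%:~R * a -> a = 0.
  move=> nm /eqP; rewrite mulr0 sub0r -subr_eq0 -mulrBl -rmorphB mulf_eq0.
  by rewrite intr_eq0 opprK addrC subr_eq0 (negPf nm) => /eqP.
apply: (coord_inj (w := B)) => n; rewrite !coordE;
  have [->|nm] := eqVneq m n; rewrite ?mulr1 !mulr0 ?addr0 ?add0r //.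
- apply: (key _ n); first by rewrite eq_sym.
  by have := congr1 (cL n) eqd; rewrite coordE coord_brE subr0.
- apply: (key _ n); first by rewrite eq_sym.
  by have := congr1 (cI n) eqd; rewrite coordE coord_brE subr0.
Qed.

(** Such a derivation is given by d L_m = f(m) L_m + g(m) I_m and
    d I_m = h(m) L_m + q(m) I_m.  The brackets of two L's make f and g linear
    in m, those of L_m with I_0 give h(m) = h(0) and q(m) = f(m) + q(0), and
    [I_1, I_0] = 0 forces h = 0.  The linear parts f and g are accounted for by
    ad L_0 and ad I_0, the constant q(0) by outer. *)
Lemma derivation_L0_kill_form d : is_derivation br d -> d (L 0) = 0 ->
  exists v k, d =1 (fun x => br v x + k *: outer x).
Proof.
move=> der dL0; have [ld dd] := der.
have [f [g dL]] : exists f g, forall m, d (L m) = f m *: L m + g m *: I m.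
  exists (fun m => cL m (d (L m))), (fun m => cI m (d (L m))) => m.
  by apply: derivation_homogeneous; rewrite // br_LL sub0r add0r.
have [h [q dI]] : exists h q, forall m, d (I m) = h m *: L m + q m *: I m.
  exists (fun m => cL m (d (I m))), (fun m => cI m (d (I m))) => m.
  by apply: derivation_homogeneous; rewrite // br_LI sub0r add0r.
have eqLL m n : (m - n)%:~R *: d (L (m + n)) =
    (m - n)%:~R *: ((f m + f n) *: L (m + n) + (g m + g n) *: I (m + n)).
  rewrite -(lin_Z _ _ ld) -br_LL dd !dL !brE.
  by apply: (coord_inj (w := B)) => p; rewrite !coordE; ring.
have eqLI m n : (m - n)%:~R *: d (I (m + n)) =
    (m - n)%:~R *: (h n *: L (m + n) + (f m + q n) *: I (m + n)).
  rewrite -(lin_Z _ _ ld) -br_LI dd dL dI !brE.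
  by apply: (coord_inj (w := B)) => p; rewrite !coordE; ring.
have eqII m n : (m - n)%:~R * (h m + h n) = 0.
  have := congr1 (cI (m + n)) (dd (I m) (I n)).
  rewrite br_II dI (dI n) !brE (lin_0 ld) !coordE eqxx !mulr1.
  by move=> ->; ring.
have cancel m n x y : m != n -> (m - n)%:~R *: x = (m - n)%:~R *: y -> x = y.
  by move=> mn; apply: scalerI; rewrite intr_eq0 subr_eq0.
have fE : forall m, f m = m%:~R * f 1.
  apply: additive_off_diagonal => m n /cancel/(_ (eqLL m n)).
  move/(congr1 (cL (m + n))).
  by rewrite dL !coordE eqxx !mulr1 !mulr0 !addr0.
have gE : forall m, g m = m%:~R * g 1.
  apply: additive_off_diagonal => m n /cancel/(_ (eqLL m n)).
  move/(congr1 (cI (m + n))).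
  by rewrite dL !coordE eqxx !mulr1 !mulr0 !add0r.
have h0 : h 0 = 0.
  have /(congr1 (cL 1)) := cancel 1 0 _ _ isT (eqLI 1 0).
  rewrite addr0 dI !coordE eqxx !mulr1 !mulr0 !addr0 => h1.
  have /eqP := eqII 1 0.
  by rewrite h1 subr0 mul1r -mulr2n mulrn_eq0 => /eqP.
have dI' m : d (I m) = (m%:~R * f 1 + q 0) *: I m.
  rewrite -fE; have [->|m0] := eqVneq m 0.
    by rewrite dI fE mul0r h0 scale0r !add0r.
  by have := cancel _ _ _ _ m0 (eqLI m 0); rewrite addr0 h0 scale0r add0r.
exists (- f 1 *: L 0 - g 1 *: I 0), (q 0); apply: linear_ext => // [|m|m].
- by case: (inner_outer_derivation (- f 1 *: L 0 - g 1 *: I 0) (q 0)).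
- rewrite outer_L dL fE gE -(scaleNr (g 1)) !brE.
  by apply: (coord_inj (w := B)) => p; rewrite !(coordE, add0r); ring.
- rewrite outer_I dI' -(scaleNr (g 1)) !brE.
  by apply: (coord_inj (w := B)) => p; rewrite !(coordE, add0r); ring.
Qed.

(** The classification of derivations: subtracting an inner derivation reduces
    to the case where d L_0 has only a degree 0 component, hence is zero. *)
Lemma derivation_inner_outer d : is_derivation br d ->
  exists v k, d =1 (fun x => br v x + k *: outer x).
Proof.
move=> der; have [u uL0] := inner_L0_correction (d (L 0)).
have der' := derivation_sub brP der (inner_derivation brP u).
have [|v [k dE]] := derivation_L0_kill_form der'.
  apply: derivation_L0_eq0 der' _ => n /uL0 [uL uI].
  by rewrite !coordE uL uI !subrr.
exists (u + v), k => x.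
by rewrite (brDl brP) -addrA -dE addrC subrK.
Qed.

(** * Stabilizers and separation of supports *)

Lemma stabilizer_L u m : br u (L m) = 0 ->
  exists a b, u = a *: L m + b *: I m.
Proof.
rewrite (brC brP) => /eqP; rewrite oppr_eq0 => /eqP Lu.
exists (cL m u), (cI m u); have key n (a : K) : n != m ->
    (2 * m - (n + m))%:~R * a = 0 -> a = 0.
  move=> nm /eqP; rewrite mulf_eq0 intr_eq0 => /orP[|/eqP//].
  by move=> e; case/eqP: nm; lia.
apply: (coord_inj (w := B)) => n; rewrite !coordE;
  have [->|nm] := eqVneq m n; rewrite ?mulr1 !mulr0 ?addr0 ?add0r //.
- apply: (key n); first by rewrite eq_sym.
  by have := congr1 (cL (n + m)) Lu; rewrite coord_brE addrK coord0.
- apply: (key n); first by rewrite eq_sym.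
  by have := congr1 (cI (n + m)) Lu; rewrite coord_brE addrK coord0.
Qed.

(** The index 2p is the one for which no inner derivation can imitate outer on
    L_p + I_q: the I_q component of [I_{q-p}, L_p] is q - 2p. *)
Definition probe p : V := L p + I (2 * p).

Lemma outer_probe p : outer (probe p) = I (2 * p).
Proof. by rewrite /probe (lin_D _ _ outer_linear) outer_L outer_I add0r. Qed.

(** Comparing L-components, the L part of u is a multiple of L_p.  The I_{2p}
    component of [u, L_p] vanishes because its structure constant does, and
    that of [u, I_{2p}] because u has no L_0 component when p is nonzero; so
    k = 0.  Thus u centralizes the probe, and the remaining components leave
    only multiples of the probe itself and of I_p. *)
Lemma stabilizer_probe p u k : p != 0 -> br u (probe p) = k *: I (2 * p) ->
  k = 0 /\ exists a b, u = a *: L p + b *: I p + a *: I (2 * p).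
Proof.
move=> p0; rewrite (brC brP) /probe => eqk.
have eqL n : (2 * p - n)%:~R * cL (n - p) u = 0.
  have := congr1 (cL n) eqk; rewrite !brE !(coordE, coord_brE) addr0 mulr0.
  by move/eqP; rewrite oppr_eq0 => /eqP.
have eqI n : (2 * p - n)%:~R * cI (n - p) u
    + (2 * (2 * p) - n)%:~R * cL (n - 2 * p) u = - (k * (2 * p == n)%:R).
  have := congr1 (cI n) eqk; rewrite !brE !(coordE, coord_brE) => <-.
  by rewrite opprK.
have int0 (r : int) (a : K) : r%:~R * a = 0 -> r != 0 -> a = 0.
  by move=> /eqP; rewrite mulf_eq0 intr_eq0 => /orP[->|/eqP].
have uL n : n != p -> cL n u = 0.
  move=> np; have := eqL (n + p); rewrite addrK => /int0; apply; lia.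
have k0 : k = 0.
  have := eqI (2 * p).
  rewrite subrr mul0r add0r uL 1?eq_sym // mulr0 eqxx mulr1.
  by move/eqP; rewrite eq_sym oppr_eq0 => /eqP.
split=> //; exists (cL p u), (cI p u); apply: (coord_inj (w := B)) => n.
  rewrite !coordE !mulr0 !addr0.
  by have [<-|np] := eqVneq p n; rewrite ?mulr1 // mulr0 uL // eq_sym.
rewrite !coordE mulr0 add0r.
have := eqI (n + p); rewrite k0 mul0r oppr0 addrK.
have [<-|np] := eqVneq p n.
  rewrite (_ : (2 * p == p) = false) ?mulr1 ?mulr0 ?addr0 //.
  by apply/negP => /eqP; lia.
rewrite mulr0 add0r; have [<-|n2p] := eqVneq (2 * p) n => eqn.
  have e1 : 2 * p - (2 * p + p) = - p by ring.
  have e2 : 2 * (2 * p) - (2 * p + p) = p by ring.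
  have e3 : 2 * p + p - 2 * p = p by ring.
  rewrite mulr1; apply/eqP; rewrite -subr_eq0; apply/eqP.
  apply: (int0 p) => //; rewrite -oppr0 -eqn e1 e2 e3 rmorphN; ring.
rewrite mulr0; move: eqn; rewrite uL; last by lia.
by rewrite mulr0 addr0 => /int0; apply; lia.
Qed.

(** The bracket shifts the support of x by p or 2p, so for large p it vanishes
    in the degrees where x or y may be nonzero; outside those degrees y and
    outer x are both zero. *)
Lemma shift_out_of_support x y : exists2 N : int, 0 < N & forall p a b c k,
  N < p -> y = br (a *: L p + b *: I p + c *: I (2 * p)) x + k *: outer x ->
  y = k *: outer x.
Proof.
have [Nx suppx] := coord_finite B x; have [Ny suppy] := coord_finite B y.
(* Two degrees of absolute value at most Nx + Ny differ by less than this. *)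
exists (Nx + Ny).*2.+1%:Z => // p a b c k ltNp eqy.
have brxE n : (cL n (br (a *: L p + b *: I p + c *: I (2 * p)) x) =
      a * ((2 * p - n)%:~R * cL (n - p) x))
    * (cI n (br (a *: L p + b *: I p + c *: I (2 * p)) x) =
      a * ((2 * p - n)%:~R * cI (n - p) x)
      + b * ((2 * p - n)%:~R * cL (n - p) x)
      + c * ((2 * (2 * p) - n)%:~R * cL (n - 2 * p) x)).
  by rewrite !brE !(coordE, coord_brE) !mulr0 !addr0.
apply: (coord_inj (w := B)) => n; have [small|large] := leqP `|n| (Nx + Ny).
- rewrite {1}eqy coordD brxE.
  by rewrite (proj1 (suppx (n - p) _)) ?mulr0 ?add0r //; lia.
- have [-> _] : cL n y = 0 /\ cI n y = 0 by apply: suppy; lia.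
  by rewrite coordZ coord_outer mulr0.
- rewrite {1}eqy coordD brxE.
  have [-> ->] : cL (n - p) x = 0 /\ cI (n - p) x = 0 by apply: suppx; lia.
  have [-> _] : cL (n - 2 * p) x = 0 /\ cI (n - 2 * p) x = 0.
    by apply: suppx; lia.
  by rewrite !mulr0 !add0r.
- have [_ ->] : cL n y = 0 /\ cI n y = 0 by apply: suppy; lia.
  have [_ eqx] : cL n x = 0 /\ cI n x = 0 by apply: suppx; lia.
  by rewrite coordZ coord_outer eqx mulr0.
Qed.

(** * Two-local derivations *)

Lemma local_inner_outer D x y : is_2local_derivation br D ->
  exists v k, D x = br v x + k *: outer x /\ D y = br v y + k *: outer y.
Proof.
move=> /(_ x y)[d [/derivation_inner_outer[v [k dE]] -> ->]].
by exists v, k; rewrite !dE.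
Qed.

(** Comparison with L_0 puts D L_m in degree m, comparison with L_1 puts it in
    degree m + 1. *)
Lemma local_vanishes_at_L D m : is_2local_derivation br D ->
  D (L 0) = 0 -> D (L 1) = 0 -> D (L m) = 0.
Proof.
move=> locD D0 D1.
have form p : D (L p) = 0 -> exists a b,
    D (L m) = (p - m)%:~R *: (a *: L (p + m) + b *: I (p + m)).
  move=> Dp; have [v [k [Dpv ->]]] := local_inner_outer (L p) (L m) locD.
  move: Dpv; rewrite Dp !outer_L scaler0 !addr0 => /esym/stabilizer_L[a [b ->]].
  exists a, b; rewrite !brE scalerDr !scalerA.
  by rewrite ![_%:~R * _]mulrC.
have [a [b eq0]] := form 0 D0; have [a' [b' eq1]] := form 1 D1.
rewrite !add0r in eq0.
apply: (coord_inj (w := B)) => n; have [<-|mn] := eqVneq m n.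
- rewrite eq1 !coordE (_ : (1 + m == m) = false) ?mulr0 ?addr0 ?mulr0 //.
  by lia.
- by rewrite eq0 !coordE (negPf mn) !mulr0 addr0 mulr0.
- rewrite eq1 !coordE (_ : (1 + m == m) = false) ?mulr0 ?addr0 ?mulr0 //.
  by lia.
- by rewrite eq0 !coordE (negPf mn) !mulr0 addr0 mulr0.
Qed.

(** Comparison with L_m for m large compared with p; the scalar k may depend on
    p at this stage. *)
Lemma local_at_probe D p : is_2local_derivation br D ->
  (forall m, D (L m) = 0) -> exists k, D (probe p) = k *: I (2 * p).
Proof.
move=> locD DL.
have [N _ shift] := shift_out_of_support (probe p) (D (probe p)).
have [v [k [Lv Dp]]] := local_inner_outer (L (N + 1)) (probe p) locD.
exists k; rewrite -outer_probe.
move: Lv; rewrite DL outer_L scaler0 addr0 => /esym/stabilizer_L[a [b vE]].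
by apply: (shift (N + 1) a b 0 k); rewrite ?scale0r ?addr0 -?vE //; lia.
Qed.

(** Here the outer coefficient is read off from the value of D at the probe,
    whatever x is: this is what makes the scalars of different x comparable. *)
Lemma local_determined_by_probe D p l x : is_2local_derivation br D ->
  p != 0 -> D (probe p) = l *: I (2 * p) ->
  exists a b, D x = br (a *: L p + b *: I p + a *: I (2 * p)) x + l *: outer x.
Proof.
move=> locD p0 Dp; have [v [k [Dpv Dx]]] := local_inner_outer (probe p) x locD.
have eqv : br v (probe p) = (l - k) *: I (2 * p).
  by rewrite scalerBl -Dp Dpv outer_probe addrK.
have [/subr0_eq lk [a [b vE]]] := stabilizer_probe p0 eqv.
by exists a, b; rewrite lk -vE.
Qed.

(** A single probe, with p large for both x and I_0, forces the scalar at x to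
    be the scalar at I_0. *)
Lemma local_normalized_outer D : is_2local_derivation br D ->
  D (L 0) = 0 -> D (L 1) = 0 -> exists k, D =1 (fun x => k *: outer x).
Proof.
move=> locD D0 D1; have DL m := local_vanishes_at_L m locD D0 D1.
exists (cI 0 (D (I 0))) => x.
have [N N0 shift] := shift_out_of_support x (D x).
have [M M0 shiftI] := shift_out_of_support (I 0) (D (I 0)).
have p0 : N + M != 0 by lia.
have [l Dp] := local_at_probe (N + M) locD DL.
have [a [b Dx]] := local_determined_by_probe x locD p0 Dp.
have [a' [b' DI]] := local_determined_by_probe (I 0) locD p0 Dp.
rewrite (shift _ _ _ _ _ _ Dx); last by lia.
by rewrite (shiftI _ _ _ _ _ _ DI) ?outer_I ?coordE ?mulr1 //; lia.
Qed.

Lemma local_derivation_is_derivation D : is_2local_derivation br D ->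
  is_derivation br D.
Proof.
move=> locD; have [d [der D0 D1]] := locD (L 0) (L 1).
have loc' := is_2local_derivation_sub brP locD der.
have [|| k Dk] := local_normalized_outer loc'.
- by rewrite D0 subrr.
- by rewrite D1 subrr.
apply: derivation_ext (derivation_comb brP k outer_derivation der) _ => x.
by rewrite -Dk subrK.
Qed.

End W22.

(** * The algebra W(2,2) *)

Lemma mcoeff_W22LE (K : fieldType) (m : int) t :
  (W22L K m)@_t = (inl m == t)%:R.
Proof. by rewrite W22LE mcoeffU. Qed.

Lemma mcoeff_W22IE (K : fieldType) (m : int) t :
  (W22I K m)@_t = (inr m == t)%:R.
Proof. by rewrite W22IE mcoeffU. Qed.

Definition W22_diag (K : fieldType) (s t : int -> K) (x : W22 K) : W22 K :=
  [malg a in msupp x => match a with inl n => s n | inr n => t n end * x@_a].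

Lemma mcoeff_W22_diag (K : fieldType) (s t : int -> K) (x : W22 K) a :
  (W22_diag s t x)@_a = match a with inl n => s n | inr n => t n end * x@_a.
Proof.
by rewrite mcoeffE; case: ifPn => // /mcoeff_outdom ->; rewrite mulr0.
Qed.

(** The spanning property for linear maps into the algebra applies to the map
    y |-> f(y) L_0. *)
Lemma W22_scalar_eq0 (K : fieldType) (f : W22 K -> K) : scalar f ->
  (forall m, f (W22L K m) = 0) -> (forall m, f (W22I K m) = 0) ->
  forall x, f x = 0.
Proof.
move=> lf fL fI x.
have lh : linear (fun y => f y *: W22L K 0).
  by move=> k y z; rewrite lf scalerDl scalerA.
have := W22_linear_eq0 lh _ _ x; rewrite /= => h.
have : f x *: W22L K 0 = 0 by apply: h => m; rewrite ?fL ?fI scale0r.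
move/(congr1 (mcoeff (inl 0))).
by rewrite mcoeffZ mcoeff0 mcoeff_W22LE eqxx mulr1.
Qed.

Lemma W22_support_bounded (K : fieldType) (x : W22 K) : exists N : nat,
  forall n : int, (N < `|n|)%N -> x@_(inl n) = 0 /\ x@_(inr n) = 0.
Proof.
pose deg (t : int + int) := `|match t with inl n | inr n => n end|%N.
exists (\max_(t <- msupp x) deg t)%N => n ltn.
have le_max t : t \in msupp x -> (deg t <= \max_(t <- msupp x) deg t)%N.
  by move=> xt; apply: leq_bigmax_seq.
by split; apply: mcoeff_outdom; apply: contraL ltn => /le_max; rewrite -leqNgt.
Qed.

Lemma mcoeff_scalar (K : fieldType) t : scalar (fun x : W22 K => x@_t).
Proof. by move=> k x y; rewrite mcoeffD mcoeffZ. Qed.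

Definition W22_canonical_basis (K : numFieldType) : W22_basis (@W22_bracket K).
Proof.
refine {| bL := W22L K; bI := W22I K;
  cL := fun n x => x@_(inl n); cI := fun n x => x@_(inr n);
  diag := @W22_diag K; br_lie := W22_is_lie_bracket K;
  br_LL := @W22_bracketLL K; br_LI := @W22_bracketLI K;
  br_II := @W22_bracketII K;
  cL_scalar := fun n => @mcoeff_scalar K (inl n);
  cI_scalar := fun n => @mcoeff_scalar K (inr n);
  scalar_eq0 := @W22_scalar_eq0 K; coord_finite := @W22_support_bounded K;
  cL_diag := fun s t n x => mcoeff_W22_diag s t x (inl n);
  cI_diag := fun s t n x => mcoeff_W22_diag s t x (inr n) |}.
- by move=> m n; rewrite mcoeff_W22LE.
- by move=> m n; rewrite mcoeff_W22LE.
- by move=> m n; rewrite mcoeff_W22IE.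
- by move=> m n; rewrite mcoeff_W22IE.
- by move=> x y xyL xyI; apply/malgP => -[n|n]; [exact: xyL | exact: xyI].
Qed.

Theorem theorem3p1 (R : realType) (Delta : W22 R[i] -> W22 R[i]) :
  is_2local_derivation (@W22_bracket R[i]) Delta ->
  is_derivation (@W22_bracket R[i]) Delta.
Proof. exact: (local_derivation_is_derivation (W22_canonical_basis R[i])). Qed.
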